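(* Let $n\ge 2$ be an integer. For positive integers $M,N$ with $n\mid M$, let $f_{M,N}$ be the number of order-$n$ ribbon tilings of the $M$-by-$N$ rectangle $R_{M,N}$. Then the limit $$\gamma_n=\lim_{M,N\to\infty,\; n\mid M}\frac{\ln f_{M,N}}{MN/n}$$ exists, and $\gamma_n\le (n-1)\ln 2$.
   Context: Unit squares are $[x,x+1]\times[y,y+1]$ with $x,y\in\mathbb Z$. An order-$n$ ribbon tile is a set of $n$ unit squares forming a sequence in which each square after the first is the square immediately above or immediately to the right of its predecessor. An order-$n$ ribbon tiling of a region is a covering of the region by non-overlapping order-$n$ ribbon tiles contained in it. The limit is a joint (double) limit as $M$ and $N$ both tend to infinity, $M$ ranging over multiples of $n$; $MN/n$ is the number of tiles in a tiling of $R_{M,N}$. *)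

(* Defs.v *)
From mathcomp Require Import all_boot all_order all_algebra finmap.
From mathcomp Require Import all_classical all_reals all_analysis.

Set Implicit Arguments.
Unset Strict Implicit.
Unset Printing Implicit Defensive.

Import Order.TTheory GRing.Theory Num.Theory.

Local Open Scope ring_scope.

(* The cell (x, y) stands for the unit square [x, x+1] x [y, y+1], and a finite
   set of cells for the union of its squares. Two such unions are
   non-overlapping (disjoint interiors) iff the sets of cells are disjoint. *)
Definition cell := (int * int)%type.

Definition above_or_right (c d : cell) : bool :=
  (d == (c.1, c.2 + 1)) || (d == (c.1 + 1, c.2)).

(* The cells of s are automatically distinct, since c.1 + c.2 increases. *)
Definition is_ribbon (n : nat) (t : {fset cell}) : Prop :=
  exists s : seq cell,
    [/\ size s = n, sorted above_or_right s & t = [fset c in s]%fset].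

Definition is_ribbon_tiling (n : nat) (A : {fset cell})
    (T : {fset {fset cell}}) : Prop :=
  [/\ forall t, t \in T -> is_ribbon n t,
      forall t, t \in T -> (t `<=` A)%fset,
      forall t u, t \in T -> u \in T -> t != u -> [disjoint t & u]%fset
    & forall c, c \in A -> exists2 t, t \in T & c \in t].

(* The double powerset loses no tiling, as tiles are contained in A. *)
Definition ribbon_tilings (n : nat) (A : {fset cell}) :
    {fset {fset {fset cell}}} :=
  [fset T in fpowerset (fpowerset A) | `[< is_ribbon_tiling n A T >]]%fset.

Definition rectangle (M N : nat) : {fset cell} :=
  [fset (Posz i, Posz j) | i in iota 0 M, j in iota 0 N]%fset.

Definition num_ribbon_tilings (n M N : nat) : nat :=
  #|` ribbon_tilings n (rectangle M N)|.

(* Main.v *)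
Require Import Defs.
From mathcomp Require Import all_boot all_order all_algebra finmap zify ring lra.
From mathcomp Require Import all_classical all_reals all_analysis.

(* Order the cells by x + y.  In a tiling, the tile covering a lowest cell must
   start there, so it is given by n - 1 up/right choices; peeling tiles off one
   by one bounds the number of tilings by 2^((n-1) * number of tiles).  Putting
   tilings side by side makes ln f superadditive in each of M and N, and
   rows of horizontal tiles show f >= 1, so a two-dimensional Fekete argument
   gives convergence of the normalised logarithm to its supremum. *)

Set Implicit Arguments.
Unset Strict Implicit.
Unset Printing Implicit Defensive.

Import Order.TTheory GRing.Theory Num.Theory.
Import numFieldNormedType.Exports.

Local Open Scope classical_set_scope.
Local Open Scope ring_scope.

Lemma leq_card_bigfcup (I : Type) (K : choiceType) (r : seq I)
    (F : I -> {fset K}) :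
  (#|` \bigcup_(i <- r) F i|%fset <= \sum_(i <- r) #|` F i|)%N.
Proof.
elim/big_ind2: _ => [|B b C c leB leC|//]; first by rewrite cardfs0.
by apply: leq_trans (leq_add leB leC); rewrite leq_card_fsetU.
Qed.

(** * Ribbon tiles as up/right walks *)

Definition level (c : cell) : int := c.1 + c.2.

Definition step (c : cell) (b : bool) : cell :=
  if b then (c.1, c.2 + 1) else (c.1 + 1, c.2).

(** [scanl] omits its starting point, hence the explicit [c]; a sequence of [n] choices encodes a
    tile of order [n.+1]. *)
Definition walk (c : cell) (b : seq bool) : {fset cell} :=
  [fset x in c :: scanl step c b]%fset.

Lemma above_or_rightP c d :
  reflect (exists b, d = step c b) (above_or_right c d).
Proof.
apply: (iffP orP) => [[] /eqP ->|[[] ->]]; [by exists true|by exists false| |].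
  by left.
by right.
Qed.

Lemma path_walk c s : path above_or_right c s ->
  exists2 b, size b = size s & s = scanl step c b.
Proof.
elim: s c => [|d s IHs] c /=; first by exists [::].
case/andP=> /above_or_rightP[e ->] /IHs [b sz_b def_s].
by exists (e :: b); rewrite /= ?sz_b -?def_s.
Qed.

Lemma path_level c s : path above_or_right c s ->
  path (relpre level <%R) c s.
Proof.
by apply: sub_path => x y /above_or_rightP[[] ->]; rewrite /level /=; lia.
Qed.

Lemma level_trans : transitive (relpre level <%R).
Proof. by move=> x y z /=; apply: lt_trans. Qed.

Lemma card_ribbon n t : is_ribbon n t -> #|` t|%fset = n.
Proof.
case=> -[|c s] [<- sorted_s ->]; first by rewrite card_fseq.
rewrite card_fseq undup_id //.
by apply: (@sorted_uniq _ _ level_trans _ (c :: s)) (path_level sorted_s) => x /=;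
  rewrite ltxx.
Qed.

(** The level strictly increases along a ribbon, so a cell of minimal level can only be its first
    cell, and the remaining cells are read off from the steps. *)
Lemma ribbon_walk n t c : is_ribbon n.+1 t -> c \in t ->
    (forall d, d \in t -> level c <= level d) ->
  exists b : n.-tuple bool, t = walk c b.
Proof.
case=> -[|c0 s] [// [sz_s]] /= path_s ->; rewrite in_fset => c_s c_min.
have [b sz_b def_s] := path_walk path_s.
have -> : c = c0.
  have /allP c0_min := order_path_min level_trans (path_level path_s).
  move: c_s; rewrite inE => /predU1P[//|/c0_min /=].
  by rewrite ltNge c_min // in_fset mem_head.
have sz_bn : size b == n by rewrite sz_b sz_s.
by exists (Tuple sz_bn); rewrite /walk -def_s.
Qed.

(** * Tilings of a finite region and the upper bound on their number *)

Lemma ribbon_tilingsP n A T :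
  reflect (is_ribbon_tiling n A T) (T \in ribbon_tilings n A).
Proof.
rewrite /ribbon_tilings !inE /=; apply: (iffP andP) => [[_ /asboolP]//|tT].
split; last exact/asboolP.
have [_ TA _ _] := tT.
by rewrite fpowersetE; apply/fsubsetP => t /TA; rewrite fpowersetE.
Qed.

Lemma exists_min_level (A : {fset cell}) : A != fset0 ->
  exists2 c, c \in A & forall d, d \in A -> level c <= level d.
Proof.
case/fset0Pn=> c0 Ac0.
case: (@arg_minP _ _ _ [` Ac0]%fset predT (fun x => level (val x))) => // c _ Hc.
exists (val c) => [|d Ad]; first exact: valP.
exact: (Hc [` Ad]%fset).
Qed.

Lemma ribbon_tiling_rem n A T t : is_ribbon_tiling n A T -> t \in T ->
  is_ribbon_tiling n (A `\` t)%fset (T `\ t)%fset.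
Proof.
case=> ribT TA disjT covT tT; split.
- by move=> u /fsetD1P[_ /ribT].
- move=> u /fsetD1P[ut uT]; rewrite fsubsetD TA //=.
  exact: disjT.
- by move=> u v /fsetD1P[_ uT] /fsetD1P[_ vT]; exact: disjT.
- move=> c /fsetDP[cA ct]; have [u uT cu] := covT c cA.
  by exists u => //; rewrite !inE uT andbT; apply: contraNneq ct => <-.
Qed.

(** Strong induction on the number of cells: the tile through a lowest cell is one of [2 ^ n] walks,
    and deleting it leaves [n.+1] fewer cells, which lowers the quotient by one. *)
Lemma card_ribbon_tilings_le n A :
  (#|` ribbon_tilings n.+1 A|%fset <= (2 ^ n) ^ (#|` A|%fset %/ n.+1))%N.
Proof.
have [k] := ubnP #|` A|%fset; elim: k A => // k IHk A leAk.
have [->|A0] := eqVneq A fset0.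
  (* A tile has [n.+1 > 0] cells, so the empty region has at most the empty tiling. *)
  rewrite cardfs0 div0n expn0 -(cardfs1 (fset0 : {fset {fset cell}})).
  apply/fsubset_leq_card/fsubsetP => T /ribbon_tilingsP[ribT TA _ _].
  rewrite inE; apply/negPn/negP => /fset0Pn[t tT].
  by have := fsubset_leq_card (TA t tT); rewrite (card_ribbon (ribT t tT)) cardfs0.
(* If a tiling exists, its tile at the lowest cell shows [n.+1 <= #|A|]; the quotient is then
   positive and its predecessor is genuine. *)
have [->|] := eqVneq (ribbon_tilings n.+1 A) fset0; first by rewrite cardfs0.
case/fset0Pn=> T0 /ribbon_tilingsP tT0.
have [c cA c_min] := exists_min_level A0.
have walkP T : is_ribbon_tiling n.+1 A T ->
    exists2 b : n.-tuple bool, walk c b \in T &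
      (walk c b `<=` A)%fset /\ #|` walk c b|%fset = n.+1.
  case=> ribT TA _ /(_ c cA)[t tT ct].
  have [b tE] : exists b : n.-tuple bool, t = walk c b.
    apply: ribbon_walk (ribT t tT) ct _ => d /(fsubsetP (TA t tT)); exact: c_min.
  by exists b; rewrite -tE // TA // (card_ribbon (ribT t tT)).
have leA : (n.+1 <= #|` A|%fset)%N.
  by have [b _ [bA <-]] := walkP _ tT0; apply: fsubset_leq_card.
(* [F b] collects the tilings in which [walk c b] is a tile. The guard provides what is needed to
   count the cells of the remaining region; otherwise the contribution is empty. *)
pose F (b : n.-tuple bool) : {fset {fset {fset cell}}} :=
  if (walk c b `<=` A)%fset && (#|` walk c b|%fset == n.+1) then
    [fset (walk c b |` T)%fset | T in ribbon_tilings n.+1 (A `\` walk c b)%fset]%fset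
  else fset0.
have leF b : (#|` F b|%fset <= (2 ^ n) ^ (#|` A|%fset %/ n.+1).-1)%N.
  rewrite /F; case: ifP => [/andP[bA /eqP sz_b]|_]; last by rewrite cardfs0.
  apply: leq_trans (leq_imfset_card _ _ _) _.
  have cardD : #|` A `\` walk c b|%fset = (#|` A|%fset - n.+1)%N.
    by rewrite cardfsDS // sz_b.
  apply: leq_trans (IHk _ _) _; rewrite cardD; first by lia.
  by rewrite -[X in (_ <= _ ^ (X %/ _).-1)%N](subnK leA) divnDr // divnn addn1.
apply: (@leq_trans #|` \bigcup_(b <- enum {: n.-tuple bool}) F b|%fset).
  apply/fsubset_leq_card/fsubsetP => T /ribbon_tilingsP tT.
  have [b bT [bA sz_b]] := walkP T tT.
  apply/bigfcupP; exists b; first by rewrite mem_enum.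
  rewrite /F bA sz_b eqxx; apply/imfsetP; exists (T `\ walk c b)%fset => /=.
    by apply/ribbon_tilingsP; exact: ribbon_tiling_rem.
  by rewrite fsetD1K.
apply: leq_trans (leq_card_bigfcup _ _) _.
apply: leq_trans (leq_sum _ (fun b _ => leF b)) _.
rewrite big_const_seq count_predT iter_addn_0 -cardE card_tuple card_bool.
by rewrite mulnC -expnS prednK // divn_gt0.
Qed.

(** * Tilings of disjoint unions *)

Lemma card_ribbon_tilingsU n A B : (0 < n)%N -> [disjoint A & B]%fset ->
  (#|` ribbon_tilings n A|%fset * #|` ribbon_tilings n B|%fset
     <= #|` ribbon_tilings n (A `|` B)%fset|%fset)%N.
Proof.
move=> n_gt0 disjAB.
rewrite -(size_allpairs (fun T U => T `|` U)%fset).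
have filterE A' B' T U : [disjoint A' & B']%fset ->
    is_ribbon_tiling n A' T -> is_ribbon_tiling n B' U ->
    T = [fset t in (T `|` U)%fset | t `<=` A']%fset.
  move=> disjAB' [_ TA _ _] [ribU UB _ _].
  apply/fsetP => t; rewrite !inE /=; apply/idP/andP => [tT|[/orP[//|tU] tA]].
    by rewrite tT TA.
  have := card_ribbon (ribU t tU).
  suff -> : t = fset0 by rewrite cardfs0 => n0; rewrite -n0 in n_gt0.
  apply/eqP; rewrite -fsubset0 -(disjoint_fsetI0 disjAB').
  by rewrite fsubsetI tA UB.
apply: uniq_leq_size.
  apply: allpairs_uniq; rewrite ?fset_uniq //.
  move=> [T U] [T' U'].
  case/allpairsP=> -[? ?] /= [/ribbon_tilingsP tT /ribbon_tilingsP tU [-> ->]].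
  case/allpairsP=> -[? ?] /= [/ribbon_tilingsP tT' /ribbon_tilingsP tU' [-> ->]].
  move=> eqTU.
  rewrite (filterE _ _ _ _ disjAB tT tU) eqTU -(filterE _ _ _ _ disjAB tT' tU').
  congr (_, _).
  have disjBA : [disjoint B & A]%fset by rewrite fdisjoint_sym.
  rewrite (filterE _ _ _ _ disjBA tU tT) fsetUC eqTU fsetUC.
  by rewrite -(filterE _ _ _ _ disjBA tU' tT').
move=> _ /allpairsP[[T U] /= [/ribbon_tilingsP tT /ribbon_tilingsP tU ->]].
have [ribT TA disjT covT] := tT; have [ribU UB disjU covU] := tU.
have disjTU t u : t \in T -> u \in U -> [disjoint t & u]%fset.
  move=> /TA tA /UB uB; apply: fdisjointWl tA _; exact: fdisjointWr uB _.
apply/ribbon_tilingsP; split.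
- by move=> t /fsetUP[/ribT|/ribU].
- move=> t /fsetUP[/TA tA|/UB tB].
    exact: fsubset_trans tA (fsubsetUl _ _).
  exact: fsubset_trans tB (fsubsetUr _ _).
- move=> t u /fsetUP[tT'|tU'] /fsetUP[uT|uU] tu.
  + exact: disjT.
  + exact: disjTU.
  + by rewrite fdisjoint_sym disjTU.
  + exact: disjU.
- move=> c /fsetUP[/covT[t tT' ct]|/covU[t tU' ct]]; exists t => //.
    by rewrite inE tT'.
  by rewrite inE tU' orbT.
Qed.

(** * Translations of regions and tilings *)

Definition translate (v c : cell) : cell := (v.1 + c.1, v.2 + c.2).

Definition shift (v : cell) (A : {fset cell}) : {fset cell} :=
  [fset translate v c | c in A]%fset.

Lemma translate_inj v : injective (translate v).
Proof. by move=> [x y] [x' y'] [/addrI -> /addrI ->]. Qed.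

Lemma translateK v c : translate v (c.1 - v.1, c.2 - v.2) = c.
Proof. by case: c => x y; congr (_, _); rewrite /= addrC subrK. Qed.

Lemma mem_translate_shift v A c : (translate v c \in shift v A) = (c \in A).
Proof. by rewrite mem_imfset //; exact: translate_inj. Qed.

Lemma mem_shift v A c : (c \in shift v A) = ((c.1 - v.1, c.2 - v.2) \in A).
Proof. by rewrite -(mem_translate_shift v A) translateK. Qed.

Lemma shift_inj v : injective (shift v).
Proof.
move=> A B eqAB; apply/fsetP => c.
by rewrite -(mem_translate_shift v A) eqAB mem_translate_shift.
Qed.

Lemma is_ribbon_shift n v t : is_ribbon n t -> is_ribbon n (shift v t).
Proof.
case=> s [sz_s sorted_s ->]; exists (map (translate v) s); split.
- by rewrite size_map.
- rewrite sorted_map; apply: sub_sorted sorted_s => c d /above_or_rightP[b ->].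
  by apply/above_or_rightP; exists b; case: b; congr (_, _); rewrite /= addrA.
- apply/fsetP => c; rewrite mem_shift !in_fset.
  by rewrite -[in RHS](translateK v c) (mem_map (@translate_inj v)).
Qed.

Lemma card_ribbon_tilings_shift n v A :
  (#|` ribbon_tilings n A|%fset <= #|` ribbon_tilings n (shift v A)|%fset)%N.
Proof.
pose img (T : {fset {fset cell}}) := [fset shift v t | t in T]%fset.
have mem_img T t : (shift v t \in img T) = (t \in T).
  by rewrite mem_imfset //; exact: shift_inj.
have inj_img : injective img.
  by move=> T U eqTU; apply/fsetP => t; rewrite -(mem_img T) eqTU mem_img.
have <- : #|` img @` ribbon_tilings n A|%fset = #|` ribbon_tilings n A|%fset.
  exact: card_imfset.
apply/fsubset_leq_card/fsubsetP => _ /imfsetP[T /ribbon_tilingsP tT ->].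
have [ribT TA disjT covT] := tT.
apply/ribbon_tilingsP; split.
- by move=> _ /imfsetP[t /ribT rib_t ->]; exact: is_ribbon_shift.
- move=> _ /imfsetP[t /TA /fsubsetP tA ->].
  by apply/fsubsetP => c; rewrite !mem_shift; exact: tA.
- move=> _ _ /imfsetP[t /= tT' ->] /imfsetP[u /= uT ->] tu.
  have /fdisjointP disj_tu : [disjoint t & u]%fset.
    by apply: disjT => //; apply: contraNneq tu => ->.
  by apply/fdisjointP => c; rewrite !mem_shift; exact: disj_tu.
- move=> c; rewrite mem_shift => /covT[t tT' ct].
  by exists (shift v t); rewrite ?mem_shift //; apply/imfsetP; exists t.
Qed.

(** * Rectangles: superadditivity and positivity of the counts *)

Lemma mem_rectangle M N (c : cell) :
  (c \in rectangle M N) = [&& 0 <= c.1, c.1 < M%:Z, 0 <= c.2 & c.2 < N%:Z].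
Proof.
case: c => x y /=; apply/imfset2P/idP => /= [[i /= iM [j jN [-> ->]]]|].
  move: iM jN; rewrite !mem_iota; lia.
case/and4P => x0 xM y0 yN; exists (absz x); first by rewrite /= mem_iota; lia.
exists (absz y); first by rewrite /= mem_iota; lia.
by congr (_, _); lia.
Qed.

Lemma card_rectangle M N : #|` rectangle M N|%fset = (M * N)%N.
Proof.
have <- : size [seq (Posz i, Posz j) | i <- iota 0 M, j <- iota 0 N] = (M * N)%N.
  by rewrite size_allpairs !size_iota.
apply: perm_size; apply: uniq_perm; rewrite ?fset_uniq //.
  by apply: allpairs_uniq; rewrite ?iota_uniq // => -[? ?] [? ?] _ _ [-> ->].
move=> c; apply/imfset2P/allpairsP => [[i iM [j jN ->]]|[[i j] /= [iM jN ->]]].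
  by exists (i, j).
by exists i => //; exists j.
Qed.

(** A vertical line cuts the wide rectangle into one rectangle and a translate of the other, and
    tilings of the two pieces combine freely. *)
Lemma num_ribbon_tilingsDl n M1 M2 N : (0 < n)%N ->
  (num_ribbon_tilings n M1 N * num_ribbon_tilings n M2 N
     <= num_ribbon_tilings n (M1 + M2) N)%N.
Proof.
move=> n_gt0; pose B := shift (Posz M1, 0) (rectangle M2 N).
have disj : [disjoint rectangle M1 N & B]%fset.
  apply/fdisjointP => c; rewrite mem_shift !mem_rectangle /=; lia.
have -> : num_ribbon_tilings n (M1 + M2) N =
    #|` ribbon_tilings n (rectangle M1 N `|` B)%fset|%fset.
  congr #|` ribbon_tilings n _|%fset; apply/fsetP => c.
  rewrite inE mem_shift !mem_rectangle /=; lia.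
apply: leq_trans _ (card_ribbon_tilingsU n_gt0 disj).
by rewrite leq_mul2l card_ribbon_tilings_shift orbT.
Qed.

Lemma num_ribbon_tilingsDr n M N1 N2 : (0 < n)%N ->
  (num_ribbon_tilings n M N1 * num_ribbon_tilings n M N2
     <= num_ribbon_tilings n M (N1 + N2))%N.
Proof.
move=> n_gt0; pose B := shift (0, Posz N1) (rectangle M N2).
have disj : [disjoint rectangle M N1 & B]%fset.
  apply/fdisjointP => c; rewrite mem_shift !mem_rectangle /=; lia.
have -> : num_ribbon_tilings n M (N1 + N2) =
    #|` ribbon_tilings n (rectangle M N1 `|` B)%fset|%fset.
  congr #|` ribbon_tilings n _|%fset; apply/fsetP => c.
  rewrite inE mem_shift !mem_rectangle /=; lia.
apply: leq_trans _ (card_ribbon_tilingsU n_gt0 disj).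
by rewrite leq_mul2l card_ribbon_tilings_shift orbT.
Qed.

Lemma num_ribbon_tilings_area0 n M N : (M * N = 0)%N ->
  (0 < num_ribbon_tilings n M N)%N.
Proof.
rewrite -card_rectangle => /cardfs0_eq R0; rewrite cardfs_gt0.
apply/fset0Pn; exists fset0; apply/ribbon_tilingsP; rewrite R0.
by split.
Qed.

Lemma is_ribbon_row n : is_ribbon n (rectangle n 1).
Proof.
exists [seq (Posz i, 0 : int) | i <- iota 0 n]; split.
- by rewrite size_map size_iota.
- rewrite sorted_map; case: n => // n.
  (* The starting index [0] is generalised, because the tail of an [iota] starts one later. *)
  rewrite /=; elim: n (0%N) => //= n IHn m.
  rewrite IHn andbT; apply/above_or_rightP; exists false.
  by congr (_, _) => /=; lia.
- apply/fsetP => -[x y]; rewrite mem_rectangle /= in_fset.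
  apply/idP/mapP => [xy|[i]]; last by rewrite mem_iota => ? [-> ->]; lia.
  exists (absz x); first by rewrite mem_iota; lia.
  by congr (_, _); lia.
Qed.

Lemma num_ribbon_tilings_row n : (0 < num_ribbon_tilings n n 1)%N.
Proof.
rewrite cardfs_gt0; apply/fset0Pn; exists [fset (rectangle n 1)]%fset.
apply/ribbon_tilingsP; split.
- by move=> t /fset1P ->; exact: is_ribbon_row.
- by move=> t /fset1P ->.
- by move=> t u /fset1P -> /fset1P ->; rewrite eqxx.
- by move=> c cR; exists (rectangle n 1); rewrite ?inE.
Qed.

(** Adding rows, then tiles within a row, through the two superadditivity inequalities. Positivity
    makes the logarithms nonnegative and additive on products. *)
Lemma num_ribbon_tilings_gt0 n m N : (0 < n)%N ->
  (0 < num_ribbon_tilings n (n * m) N)%N.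
Proof.
move=> n_gt0; elim: N => [|N IHN].
  by apply: num_ribbon_tilings_area0; rewrite muln0.
rewrite -(addn1 N); apply: leq_trans (num_ribbon_tilingsDr _ _ _ n_gt0).
rewrite muln_gt0 IHN /=; elim: m {IHN} => [|m IHm].
  by apply: num_ribbon_tilings_area0; rewrite muln0.
rewrite mulnS; apply: leq_trans (num_ribbon_tilingsDl _ _ _ n_gt0).
by rewrite muln_gt0 IHm num_ribbon_tilings_row.
Qed.

(** * A two-dimensional Fekete lemma *)

Section Fekete.
Variables (R : realType) (a : nat -> nat -> R) (C : R).
Hypothesis a_ge0 : forall m N, 0 <= a m N.
Hypothesis aDl : forall m1 m2 N, a m1 N + a m2 N <= a (m1 + m2)%N N.
Hypothesis aDr : forall m N1 N2, a m N1 + a m N2 <= a m (N1 + N2)%N.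
Hypothesis a_le : forall m N, a m N <= C * (m * N)%:R.

Lemma superadditive_mul p q k l : (p * q)%:R * a k l <= a (p * k)%N (q * l)%N.
Proof.
have aMl N : p%:R * a k N <= a (p * k)%N N.
  elim: p => [|p IHp]; first by rewrite mul0r.
  rewrite mulSn; apply: le_trans (aDl _ _ _).
  by rewrite -natr1 mulrDl mul1r addrC lerD2l.
apply: le_trans (aMl _); rewrite natrM -mulrA ler_wpM2l //.
elim: q => [|q IHq]; first by rewrite mul0r.
rewrite mulSn; apply: le_trans (aDr _ _ _).
by rewrite -natr1 mulrDl mul1r addrC lerD2l.
Qed.

(** Superadditivity leaves over only the nonnegative values on the added strips. *)
Lemma superadditive_mono m m' N N' : (m <= m')%N -> (N <= N')%N ->
  a m N <= a m' N'.
Proof.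
move=> /subnKC <- /subnKC <-.
apply: le_trans (aDl _ _ _); rewrite ler_wpDr //.
by apply: le_trans (aDr _ _ _); rewrite ler_wpDr.
Qed.

(* Fill m-by-N with (m %/ k) * (N %/ l) copies of k-by-l. *)
Lemma superadditive_density_ge k l m N : (0 < k)%N -> (0 < l)%N ->
  (k <= m)%N -> (l <= N)%N ->
  a k l / (k * l)%:R * ((1 - k%:R / m%:R) * (1 - l%:R / N%:R))
    <= a m N / (m * N)%:R.
Proof.
move=> k0 l0 km lN.
have m0 : (0 : R) < m%:R by rewrite ltr0n; lia.
have N0 : (0 : R) < N%:R by rewrite ltr0n; lia.
have k0' : (0 : R) < k%:R by rewrite ltr0n.
have l0' : (0 : R) < l%:R by rewrite ltr0n.
rewrite (natrM _ m N) ler_pdivlMr ?mulr_gt0 //.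
have -> : a k l / (k * l)%:R * ((1 - k%:R / m%:R) * (1 - l%:R / N%:R))
      * (m%:R * N%:R)
    = ((m%:R - k%:R) / k%:R) * ((N%:R - l%:R) / l%:R) * a k l.
  by rewrite natrM; field; rewrite !gt_eqF.
apply: le_trans (superadditive_mono (leq_trunc_div m k) (leq_trunc_div N l)).
apply: le_trans (superadditive_mul _ _ _ _).
(* Rounding down loses less than one, [p / q - 1 <= p %/ q]; this yields the factors [1 - k / m] and
   [1 - l / N]. *)
have divP (p q : nat) : (0 < q)%N -> (p%:R - q%:R) / q%:R <= (p %/ q)%:R :> R.
  move=> q0; rewrite ler_pdivrMr ?ltr0n // lerBlDr -natrM -natrD ler_nat.
  by have := ltn_ceil p q0; rewrite mulSn; lia.
rewrite ler_wpM2r // natrM ler_pM ?divP //.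
- by rewrite divr_ge0 ?subr_ge0 ?ler_nat.
- by rewrite divr_ge0 ?subr_ge0 ?ler_nat.
Qed.

Lemma superadditive2_cvg : exists2 gamma : R,
  a mN.1 mN.2 / (mN.1 * mN.2)%N%:R @[mN --> filter_prod \oo \oo] --> gamma
  & gamma <= C.
Proof.
pose S := [set d : R | exists k l,
  [/\ (0 < k)%N, (0 < l)%N & d = a k l / (k * l)%:R]].
have S_ub : ubound S C.
  move=> _ [k [l [k0 l0 ->]]]; rewrite ler_pdivrMr ?a_le // ltr0n muln_gt0.
  by rewrite k0.
have S0 : S !=set0 by exists (a 1 1 / (1 * 1)%:R); exists 1%N, 1%N.
(* The limit is the supremum of all block densities. Every density lies below it, so only the lower
   estimate needs large [m] and [N]. *)
exists (sup S); last exact: ge_sup.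
apply/cvgrPdist_le => e e_gt0.
have e2_gt0 : 0 < e / 2 by rewrite divr_gt0.
have supS : has_sup S by split=> //; exists C.
(* A block with density within [e / 2] of the supremum; the other half of [e] pays for the
   boundary. *)
have [_ [k [l [k0 l0 ->]]] d_gt] := sup_adherent e2_gt0 supS.
set d := a k l / (k * l)%:R in d_gt.
have d_ge0 : 0 <= d by rewrite divr_ge0.
(* These thresholds give [d * (k / m) <= e / 4] and [d * (l / N) <= e / 4]. *)
exists ([set m | (k <= m)%N /\ 4 * d * k%:R / e <= m%:R],
        [set N | (l <= N)%N /\ 4 * d * l%:R / e <= N%:R]).
  split=> /=; near=> m; split; near: m;
    (exact: nbhs_infty_ge) || exact: nbhs_infty_ger.
move=> [m N] /= [[km dm] [lN dN]].
have m0 : (0 < m)%N by lia.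
have N0 : (0 < N)%N by lia.
have amN_le : a m N / (m * N)%:R <= sup S.
  by apply: ub_le_sup; [exists C|exists m, N].
have amN_ge := superadditive_density_ge k0 l0 km lN; rewrite -/d in amN_ge.
rewrite ger0_norm ?subr_ge0 // lerBlDr.
have dk : d * (k%:R / m%:R) <= e / 4.
  by rewrite mulrA ler_pdivrMr ?ltr0n //; move: dm; rewrite ler_pdivrMr //; lra.
have dl : d * (l%:R / N%:R) <= e / 4.
  by rewrite mulrA ler_pdivrMr ?ltr0n //; move: dN; rewrite ler_pdivrMr //; lra.
have : 0 <= d * ((k%:R / m%:R) * (l%:R / N%:R)) by rewrite !mulr_ge0 ?invr_ge0.
move: amN_ge; set x := k%:R / m%:R in dk *; set y := l%:R / N%:R in dl *.
have -> : d * ((1 - x) * (1 - y)) = d - d * x - d * y + d * (x * y) by ring.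
lra.
Unshelve. all: by end_near.
Qed.

End Fekete.

(** * The limit for ribbon tilings of rectangles *)

Theorem theorem1 (R : realType) (n : nat) (hn : (2 <= n)%N) :
  exists gamma : R,
    (ln ((num_ribbon_tilings n MN.1 MN.2)%:R : R)
       / ((MN.1 * MN.2)%N%:R / n%:R))
      @[MN --> within [set MN : nat * nat | (n %| MN.1)%N]
                 (filter_prod \oo \oo)] --> gamma
    /\ gamma <= (n - 1)%N%:R * ln 2.
Proof.
have n_gt0 : (0 < n)%N by lia.
(* Measuring widths in units of [n] removes the divisibility condition and turns the normalisation
   [M * N / n] into [m * N]. *)
pose f m N := num_ribbon_tilings n (n * m) N.
pose a m N : R := ln (f m N)%:R.
have f_gt0 m N : (0 : R) < (f m N)%:R by rewrite ltr0n num_ribbon_tilings_gt0.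
have ln_le (p q : nat) : (0 < p)%N -> (p <= q)%N -> ln p%:R <= ln q%:R :> R.
  move=> p0 pq; rewrite ler_ln ?ler_nat // posrE ltr0n //.
  exact: leq_trans pq.
have a_ge0 m N : 0 <= a m N.
  by rewrite ln_ge0 // ler1n num_ribbon_tilings_gt0.
have aDl m1 m2 N : a m1 N + a m2 N <= a (m1 + m2)%N N.
  rewrite -lnM ?posrE // -natrM; apply: ln_le.
    by rewrite muln_gt0 !num_ribbon_tilings_gt0.
  by rewrite /f mulnDr num_ribbon_tilingsDl.
have aDr m N1 N2 : a m N1 + a m N2 <= a m (N1 + N2)%N.
  rewrite -lnM ?posrE // -natrM; apply: ln_le.
    by rewrite muln_gt0 !num_ribbon_tilings_gt0.
  exact: num_ribbon_tilingsDr.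
have a_le m N : a m N <= (n - 1)%N%:R * ln 2 * (m * N)%:R.
  have -> : (n - 1)%N%:R * ln 2 * (m * N)%:R
      = ln ((2 ^ (n - 1)) ^ (m * N))%N%:R :> R.
    by rewrite -expnM natrX lnXn // -[RHS]mulr_natl (natrM _ (n - 1)%N) mulrAC.
  apply: ln_le; first exact: num_ribbon_tilings_gt0.
  have := card_ribbon_tilings_le (n - 1) (rectangle (n * m) N).
  by rewrite card_rectangle -mulnA subn1 prednK // mulKn.
have [gamma a_cvg gamma_le] := superadditive2_cvg a_ge0 aDl aDr a_le.
exists gamma; split=> //; apply/cvgrPdist_le => e e_gt0.
have [[A B] /= [[M0 _ leA] [N0 _ leB]] AB] :=
  (cvgrPdist_le _ _).1 a_cvg e e_gt0.
(* With [M = m * n], the bound [n * M0 <= M] says exactly [M0 <= m]. *)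
exists ([set M | (n * M0 <= M)%N], [set N | (N0 <= N)%N]).
  by split; [exists (n * M0)%N|exists N0].
move=> [M N] /= [leM leN] /dvdnP[m defM].
rewrite {M}defM mulnC leq_pmul2r // in leM *.
have := AB (m, N) (conj (leA m leM) (leB N leN)) => /=.
rewrite /a /f (mulnC n m).
by rewrite mulnAC (natrM _ _ n) mulfK // pnatr_eq0 -lt0n.
Qed.
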